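(* Let $\{a_n\}_{n\ge 0}$ be a sequence of complex numbers, and suppose that $\chi(\{a_n\})<1$. Then the formal series $Y(z)=\sum_{n=0}^\infty a_n z^{\underline{n}}$ converges to a function $y(z)$ uniformly on every compact subset of $\mathbb{C}$. Moreover, the order of growth $\rho(y)$ of $y(z)$ coincides with $\chi(\{a_n\})$.
   Context: Falling factorial: $z^{\underline{0}}=1$ and $z^{\underline{n}}=z(z-1)\cdots(z-n+1)$ for $n=1,2,3,\dots$. For a sequence $\{\alpha_n\}$, $$\chi(\{\alpha_n\})=\limsup_{n\to\infty}\frac{n\log n}{-\log|\alpha_n|}.$$ For an entire function $f$, let $M(r,f)=\max_{|z|=r}|f(z)|$. The order of growth of $f$ is $$\rho(f)=\limsup_{r\to\infty}\frac{\log\log M(r,f)}{\log r},\qquad 0\le\rho(f)\le\infty.$$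
   Formalization: In χ, terms with |a_n| ≥ 1 are read as +∞ rather than by the printed quotient; otherwise a_n = n^n has χ = −1 < 1 though the series diverges at z = −1. Only sequences with |a_n| ≥ 1 infinitely often are affected, and for these the series always diverges at z = −1. *)

(* Defs.v *)
From mathcomp Require Import all_boot all_order all_algebra.
From mathcomp Require Import all_classical all_reals all_analysis.
From mathcomp Require Import complex.

Set Implicit Arguments.
Unset Strict Implicit.
Unset Printing Implicit Defensive.

Import Order.TTheory GRing.Theory Num.Theory.
Import numFieldNormedType.Exports.

Local Open Scope classical_set_scope.
Local Open Scope ring_scope.
Local Open Scope complex_scope.

(* [R[i]] itself carries no topology in the libraries; the alias [R[i]^o] is   *)
(* the field seen as a one-dimensional normed space over itself, so that      *)
(* [derivable] on it is complex differentiability.                            *)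
Definition Cplx (R : realType) : normedModType R[i] := R[i]^o.

(* The norm [`|z|] of the complex field takes its values in [R[i]]; [cabs] is *)
(* the same modulus, as an element of [R].                                    *)
Definition cabs (R : realType) (z : Cplx R) : R := ComplexField.Normc.normc z.

Definition ffall (R : realType) (z : Cplx R) (n : nat) : Cplx R :=
  \prod_(i < n) ((z : R[i]) - i%:R).

(* n log n / (- log |alpha_n|).  As [lne 0 = -oo] and [x / +oo = 0], the      *)
(* quotient is 0 where alpha_n = 0.  Where |alpha_n| >= 1 the denominator is  *)
(* not positive and the quotient is read as +oo: with a negative value there, *)
(* alpha_n = n ^ n would have chi = -1.                                       *)
Definition chi_term (R : realType) (alpha : nat -> Cplx R) (n : nat) : \bar R :=
  if cabs (alpha n) < 1
  then ((n%:R * ln n%:R)%:E / (- lne (cabs (alpha n))%:E))%E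
  else +oo%E.

Definition chi (R : realType) (alpha : nat -> Cplx R) : \bar R :=
  limn_esup (chi_term alpha).

Definition entire (R : realType) (f : Cplx R -> Cplx R) : Prop :=
  forall z : Cplx R, derivable f z (1 : R[i]).

Definition max_modulus (R : realType) (f : Cplx R -> Cplx R) (r : R) : R :=
  sup [set cabs (f z) | z in [set z : Cplx R | cabs z = r]].

(* [ln x = 0] for [x <= 0], so that constant functions, 0 included, have      *)
(* order 0; a nonconstant entire function has [ln (max_modulus f r) > 1] for  *)
(* large r, and the convention plays no role.                                 *)
Definition growth_order (R : realType) (f : Cplx R -> Cplx R) : \bar R :=
  limf_esup (fun r : R => (ln (ln (max_modulus f r)) / ln r)%:E) +oo%R.

Definition binomial_psum (R : realType) (a : nat -> Cplx R) (N : nat)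
    (z : Cplx R) : Cplx R :=
  \sum_(n < N) ((a n : R[i]) * ffall z n).

(* Main.v *)
Require Import Defs.
From mathcomp Require Import all_boot all_order all_algebra.
From mathcomp Require Import all_solvable all_field.
From mathcomp Require Import all_classical all_reals all_analysis.
From mathcomp Require Import complex ring lra zify.

Set Implicit Arguments.
Unset Strict Implicit.
Unset Printing Implicit Defensive.

Import Order.TTheory GRing.Theory Num.Theory.
Import numFieldNormedType.Exports.

Local Open Scope classical_set_scope.
Local Open Scope ring_scope.

(* Upper bound.  For chi < s <= 1 we have |a_n| <= K 2^-n exp(- n ln n / s), *)
(* and |z^{falling n}| <= (|z| + n)^n <= exp(n ln n / s) exp(|z|^s / s); so *)
(* the n-th term is at most K 2^-n exp(|z|^s / s), which yields locally     *)
(* uniform convergence and order at most s.  The same bound with |z| + 2 in *)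
(* place of |z| holds for the coefficients of h and of the remainder h^2 in *)
(* the expansion of the n-th term at z + h, so that the sum is entire.      *)
(* Lower bound.  The a_n are the Newton coefficients (divided differences) of *)
(* y at 0, 1, 2, ...; Cauchy's estimate for polynomials, obtained by averaging *)
(* over roots of unity, gives |a_n| <= 2 (6 / r)^n M(r, y) for r >= 2 n.  If *)
(* M(r, y) <= exp(r^s) with s < 1, the choice r = n^(1/s) gives chi <= s.   *)

(** Both inequalities compare [a n] with exp(- n ln n / s). If chi < s <= 1, the gap between chi and
    s yields a spare factor 2^-n ([chi_coef_bound]), while [exp_add_le] splits (|z| + n)^n into
    exp(n ln n / s), which the coefficient absorbs, and a factor independent of n. The resulting
    estimate [converges_at_rate] gives the convergence and, at N = 0, the order bound. The function
    is built with s = 1; [binomial_sum_unique] identifies it with the sums built for smaller s, so s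
    can approach chi. Conversely, the partial sums are Newton polynomials with nodes 0, 1, 2, ...,
    to which [newton_coef_bound] applies; letting N grow gives [binomial_coef_le], and then
    [chi_le_of_growth]. The latter needs an exponent s > 0 above the order and below chi, which
    exists once [growth_order_ge0] is known. *)

Section CauchyNewton.
Context {C : numClosedFieldType}.
Implicit Types (p : {poly C}) (a x : nat -> C) (r M z : C).

Lemma closed_prim_root_exists n :
  (n > 0)%N -> exists z : C, n.-primitive_root z.
Proof.
pose p : {poly C} := 'X^n - 1; have [r Dp] := closed_field_poly_normal p.
move=> n_gt0; rewrite (monicP _) ?monicXnsubC // scale1r in Dp.
have rn1: all n.-unity_root r by apply/allP=> z; rewrite -root_prod_XsubC -Dp.
have sz_r: (n < (size r).+1)%N.
  by rewrite -(size_prod_XsubC r id) -Dp size_XnsubC.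
have [|z] := hasP (has_prim_root n_gt0 rn1 _ sz_r); last by exists z.
by rewrite -separable_prod_XsubC -Dp separable_Xn_sub_1 // pnatr_eq0 -lt0n.
Qed.

Lemma sum_expr_unity n (w : C) : w ^+ n = 1 ->
  \sum_(i < n) w ^+ i = (if w == 1 then n%:R else 0).
Proof.
move=> wn; case: eqVneq => [->|w1].
  under eq_bigr do rewrite expr1n.
  by rewrite sumr_const card_ord.
apply: (mulfI (_ : w - 1 != 0)); first by rewrite subr_eq0.
by rewrite -subrX1 wn subrr mulr0.
Qed.

(* With w a primitive m-th root of unity and m > size p, the average of     *)
(* w^(-ij) p(w^i r) over i < m is p`_j r^j.                                 *)
Lemma cauchy_coef p r M j : 0 < r ->
  (forall z, `|z| = r -> `|p.[z]| <= M) -> `|p`_j| * r ^+ j <= M.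
Proof.
move=> r0 pM; pose m := (size p + j).+1.
have [w wprim] := @closed_prim_root_exists m isT.
have avg : \sum_(i < m) w ^+ (i * (m - j)) * p.[w ^+ i * r] =
    m%:R * (p`_j * r ^+ j).
  have szm : (size p <= m)%N by rewrite leqW ?leq_addr.
  under eq_bigr => i _ do rewrite (horner_coef_wide _ szm) mulr_sumr.
  rewrite exchange_big /= (bigD1 (inord j)) //= [X in _ + X]big1 ?addr0;
    last first.
    move=> k kj.
    transitivity (p`_k * r ^+ k * \sum_(i < m) (w ^+ (m - j + k)) ^+ i).
      rewrite mulr_sumr; apply: eq_bigr => i _.
      rewrite exprMn -!exprM mulnDl exprD [(i * k)%N]mulnC.
      rewrite [(i * (m - j))%N]mulnC.
      by ring.
    rewrite sum_expr_unity; last by rewrite exprAC (prim_expr_order wprim) expr1n.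
    rewrite -(prim_order_dvd wprim) ifF ?mulr0//.
    have jm : (j < m)%N by rewrite ltnS leq_addl.
    have km : (k < m)%N := ltn_ord k.
    (* As 0 < m - j + k < 2m, divisibility by m leaves only m - j + k = m, that is k = j. *)
    apply/negP => /dvdnP[[|[|q]]].
    - lia.
    - rewrite mul1n => h; move/eqP: kj; apply; apply: val_inj.
      rewrite /= inordK//; lia.
    - rewrite !mulSn; move: jm km; move: (q * m)%N => qm; clearbody m.
      by lia.
  have jm : (j < m)%N by rewrite ltnS leq_addl.
  have wj i : w ^+ (i * (m - j)) * (w ^+ i) ^+ j = 1.
    rewrite -exprM -exprD -mulnDr subnK ?(ltnW jm)// mulnC exprM.
    by rewrite (prim_expr_order wprim) expr1n.
  rewrite inordK// -[m in m%:R]card_ord mulr_natl -sumr_const.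
  by apply: eq_bigr => i _; rewrite -[RHS]mul1r -(wj i) exprMn; ring.
have w1 : `|w| = 1.
  apply/eqP; rewrite -(@pexpr_eq1 _ `|w| m)// -normrX (prim_expr_order wprim).
  by rewrite normr1.
have m0 : 0 < m%:R :> C by rewrite ltr0n.
rewrite -(ler_pM2l m0) -(gtr0_norm r0) -normrX -normrM -{1}(ger0_norm (ltW m0)).
rewrite -normrM -avg (le_trans (ler_norm_sum _ _ _))//.
rewrite -[m in m%:R]card_ord mulr_natl -sumr_const ler_sum// => i _.
rewrite normrM normrX w1 expr1n mul1r pM// normrM normrX w1 expr1n mul1r.
exact: gtr0_norm.
Qed.

(** A substitute for the maximum principle: by [cauchy_coef] the term of degree i is at most M / 2^i
    on the half disc, and the geometric series costs a factor 2. *)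
Lemma disc_bound p r M z : 0 < r ->
  (forall z, `|z| = r -> `|p.[z]| <= M) -> `|z| <= r / 2 -> `|p.[z]| <= 2 * M.
Proof.
move=> r0 pM zr.
have M0 : 0 <= M by apply: le_trans (pM r (gtr0_norm r0)).
rewrite horner_coef (le_trans (ler_norm_sum _ _ _))//.
have -> : 2 * M = M * 2 by ring.
apply: (@le_trans _ _ (M * \sum_(i < size p) (2^-1) ^+ i)).
  rewrite mulr_sumr ler_sum// => i _.
  rewrite normrM normrX (le_trans (ler_wpM2l _ (lerXn2r _ _ _ zr)))//.
    by rewrite nnegrE divr_ge0 ?ltW.
  by rewrite exprMn mulrA ler_wpM2r ?cauchy_coef// exprn_ge0// invr_ge0.
apply: ler_wpM2l => //.
have := subrX1 (2^-1 : C) (size p); set S := \sum_(i < _) _ => hS.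
have -> : S = 2 * (1 - 2^-1 ^+ size p).
  by rewrite -opprB hS; field.
by rewrite ler_piMr// lerBlDr lerDl exprn_ge0// invr_ge0.
Qed.

(** The nodes are arbitrary so that an induction can drop the first node and shift the others. *)
Definition newton_poly N a x : {poly C} :=
  \sum_(k < N) a k *: \prod_(i < k) ('X - (x i)%:P).

Lemma newton_polyS N a x :
  newton_poly N.+1 a x =
  (a 0)%:P + ('X - (x 0)%:P) * newton_poly N (a \o S) (x \o S).
Proof.
rewrite /newton_poly big_ord_recl big_ord0 alg_polyC; congr (_ + _).
rewrite mulr_sumr; apply: eq_bigr => k _.
by rewrite big_ord_recl -scalerAr.
Qed.

(* Each division by X - x_0 costs a factor 6 / r: on |z| = r, the difference *)
(* |p(z) - p(x_0)| is at most 3 M and |z - x_0| is at least r / 2.          *)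
Lemma newton_coef_bound n N a x r M : (n < N)%N -> 0 < r ->
  (forall i, (i <= n)%N -> `|x i| <= r / 2) ->
  (forall z, `|z| = r -> `|(newton_poly N a x).[z]| <= M) ->
  `|a n| * r ^+ n <= 2 * 6 ^+ n * M.
Proof.
elim: n N a x M => [|n IH] [|N] a x M // nN r0 xr pM.
  have := disc_bound r0 pM (xr 0%N isT).
  by rewrite newton_polyS !hornerE subrr mul0r addr0 ?(expr0, mulr1).
(* [a 0] is the value at the node [x 0], which lies in the half disc. *)
have a0 : `|a 0%N| <= 2 * M.
  have := disc_bound r0 pM (xr 0%N isT).
  by rewrite newton_polyS !hornerE subrr mul0r addr0.
have qM z : `|z| = r -> `|(newton_poly N (a \o S) (x \o S)).[z]| <= 6 * M / r.
  move=> zr; have := pM z zr; rewrite newton_polyS !hornerE.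
  set q := _.[z] => h.
  have h1 : `|(z - x 0%N) * q| <= 3 * M.
    have -> : (z - x 0%N) * q = (a 0%N + (z - x 0%N) * q) - a 0%N by ring.
    rewrite (le_trans (ler_normB _ _))// (le_trans (lerD h a0))//.
    by rewrite -{1}[M]mul1r -mulrDl.
  have h2 : r / 2 <= `|z - x 0%N|.
    apply: le_trans (lerB_dist _ _); rewrite zr lerBrDr.
    by rewrite (le_trans (lerD (lexx _) (xr 0%N isT)))// -splitr.
  rewrite ler_pdivlMr//.
  have h3 : `|q| * (r / 2) <= 3 * M.
    by rewrite (le_trans _ h1)// normrM mulrC ler_wpM2r.
  have := ler_wpM2r (ler0n _ 2) h3.
  rewrite mulrA mulfVK ?pnatr_eq0// => /le_trans; apply.
  by rewrite mulrAC -natrM.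
have := IH N (a \o S) (x \o S) _ nN r0 (fun i hi => xr i.+1 hi) qM.
rewrite /= => h; rewrite exprSr mulrA.
have := ler_wpM2r (ltW r0) h; move/le_trans; apply.
by rewrite mulrA mulfVK ?gt_eqF// [6 ^+ n.+1]exprSr !mulrA.
Qed.
End CauchyNewton.

(** * Limits superior along a filter *)

Section LimsupBounds.
Context {R : realType} {T : choiceType} {X : filteredType T}.
Implicit Types (f : X -> \bar R) (F : set (set X)).

Lemma limf_esup_lt f F (x : \bar R) : Filter F ->
  (limf_esup f F < x)%E -> F [set z | (f z < x)%E].
Proof.
move=> FF /ereal_inf_lt[_ [V FV <-]] Vx.
apply: filterS FV => z Vz /=; apply: le_lt_trans Vx.
by apply: ereal_sup_ubound; exists z.
Qed.

Lemma limf_esup_le f F (x : \bar R) :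
  F [set z | (f z <= x)%E] -> (limf_esup f F <= x)%E.
Proof.
move=> FV; apply: le_trans (_ : ereal_sup (f @` [set z | (f z <= x)%E]) <= x)%E.
  by apply: ereal_inf_lbound; exists [set z | (f z <= x)%E].
by apply: ge_ereal_sup => _ [z zx <-].
Qed.
End LimsupBounds.

(** * Real inequalities and geometric convergence *)

Section RealEstimates.
Context {R : realType}.
Implicit Types (r s t u v K : R) (n : nat).

(** Write (u + v)^t as u (u + v)^(t-1) + v (u + v)^(t-1) and use t - 1 >= 0. *)
Lemma powR_superadditive u v t : 0 <= u -> 0 <= v -> 1 <= t ->
  u `^ t + v `^ t <= (u + v) `^ t.
Proof.
move=> u0 v0 t1; have t0 : 0 < t by apply: lt_le_trans t1.
rewrite -!(mulr_powRB1 _ t0) ?addr_ge0// mulrDl lerD// ler_wpM2l//;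
  by rewrite ge0_ler_powR ?subr_ge0 ?nnegrE ?addr_ge0 ?lerDl ?lerDr.
Qed.

(* With u = r^s, we have r + n <= u^(1/s) + n^(1/s) <= (u + n)^(1/s), and   *)
(* ln (u + n) <= ln n + u / n.                                              *)
Lemma exp_add_le s r n : 0 < s -> s <= 1 -> 0 <= r ->
  (r + n%:R) ^+ n <= expR (n%:R * ln n%:R / s) * expR (r `^ s / s).
Proof.
move=> s0 s1 r0; case: n => [|n].
  by rewrite expr0 !mul0r expR0 mul1r -expR0 ler_expR divr_ge0 ?powR_ge0 ?ltW.
set m : R := n.+1%:R; have m0 : 0 < m by rewrite ltr0n.
have m1 : 1 <= m by rewrite ler1n.
set u := r `^ s; have u0 : 0 <= u by exact: powR_ge0.
have t1 : 1 <= s^-1 by rewrite invf_ge1.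
have rm0 : 0 < r + m by rewrite ltr_wpDl.
have rm : r + m <= (u + m) `^ s^-1.
  apply: le_trans (powR_superadditive u0 (ltW m0) t1).
  rewrite lerD ?le1r_powR//.
  by rewrite -powRrM mulfV ?gt_eqF// powRr1.
have lnrm : ln (r + m) <= (ln m + u / m) / s.
  apply: (@le_trans _ _ (ln ((u + m) `^ s^-1))).
    by rewrite ler_ln// ?posrE// (lt_le_trans _ rm).
  rewrite ln_powR mulrC ler_pM2r ?invr_gt0//.
  have -> : u + m = m * (1 + u / m) by field; rewrite gt_eqF.
  have um0 : 0 <= u / m by rewrite divr_ge0// ltW.
  rewrite lnM ?posrE ?ltr_wpDr//.
  by rewrite lerD2l le_ln1Dx// (lt_le_trans _ um0)// ltrN10.
rewrite -expRD -[r + m]lnK ?posrE// -expRM_natl ler_expR.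
rewrite -/m; have := ler_wpM2l (ltW m0) lnrm; move/le_trans; apply.
rewrite [X in X <= _](_ : _ = m * ln m / s + u / s)//.
by field; rewrite !gt_eqF.
Qed.

(** The intervals of radius 2K / 2^N around the partial sums are nested; the supremum of their left
    endpoints lies in all of them. *)
Lemma geometric_limit (v : nat -> R) K :
  (forall n, `|v n| <= K / 2 ^+ n) ->
  exists l, forall N, `|l - \sum_(n < N) v n| <= 2 * K / 2 ^+ N.
Proof.
move=> vK; pose S N := \sum_(n < N) v n.
have step N : S N - 2 * K / 2 ^+ N <= S N.+1 - 2 * K / 2 ^+ N.+1 /\
              S N.+1 + 2 * K / 2 ^+ N.+1 <= S N + 2 * K / 2 ^+ N.
  rewrite /S big_ord_recr /= exprS; have := vK N; rewrite ler_norml => /andP[].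
  have -> : 2 * K / (2 * 2 ^+ N) = K / 2 ^+ N by field; rewrite expf_neq0 ?pnatr_eq0.
  have -> : 2 * K / 2 ^+ N = 2 * (K / 2 ^+ N) by rewrite mulrA.
  move: (K / _) => k; move: (\sum_(i < N) _) => q; split; lra.
have K0 N : 0 <= 2 * K / 2 ^+ N.
  by have := le_trans (normr_ge0 _) (vK N) => h; rewrite -mulrA mulr_ge0.
have low m n : (m <= n)%N -> S m - 2 * K / 2 ^+ m <= S n - 2 * K / 2 ^+ n.
  elim: n => [|n IH]; first by rewrite leqn0 => /eqP ->.
  rewrite leq_eqVlt => /predU1P[->//|/IH/le_trans]; apply; exact: (step n).1.
have upp m n : (m <= n)%N -> S n + 2 * K / 2 ^+ n <= S m + 2 * K / 2 ^+ m.
  elim: n => [|n IH]; first by rewrite leqn0 => /eqP ->.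
  rewrite leq_eqVlt => /predU1P[->//|/IH]; apply: le_trans; exact: (step n).2.
have lu m n : S m - 2 * K / 2 ^+ m <= S n + 2 * K / 2 ^+ n.
  have h1 := low _ _ (leq_maxl m n); have h2 := upp _ _ (leq_maxr m n).
  move: h1 h2 (K0 (maxn m n)); lra.
pose A := range (fun N => S N - 2 * K / 2 ^+ N).
have A0 : A !=set0 by exists (S 0%N - 2 * K / 2 ^+ 0); exists 0%N.
exists (sup A) => N; rewrite -/(S N) ler_norml; apply/andP; split.
  rewrite lerBrDr addrC; apply: ub_le_sup; last by exists N.
  by exists (S 0%N + 2 * K / 2 ^+ 0) => _ [m _ <-].
rewrite lerBlDr addrC; apply: ge_sup => // _ [m _ <-]; exact: lu.
Qed.

(** The finitely many early terms are absorbed by adding all b_n 2^n with n < N to the constant. *)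
Lemma eventually_geometric (b : nat -> R) N :
  (forall n, 0 <= b n) -> (forall n, (N <= n)%N -> b n <= 1 / 2 ^+ n) ->
  exists2 K, 0 <= K & forall n, b n <= K / 2 ^+ n.
Proof.
move=> b0 bN; have t0 n : 0 <= b n * 2 ^+ n by rewrite mulr_ge0 ?exprn_ge0.
exists (1 + \sum_(n < N) b n * 2 ^+ n).
  by rewrite addr_ge0// sumr_ge0.
move=> n; have [Nn|nN] := leqP N n.
  apply: (le_trans (bN n Nn)); rewrite ler_wpM2r ?invr_ge0 ?exprn_ge0//.
  by rewrite lerDl sumr_ge0.
rewrite ler_pdivlMr ?exprn_gt0// (bigD1 (Ordinal nN)) //= addrCA lerDl.
by rewrite addr_ge0// sumr_ge0.
Qed.
End RealEstimates.

(** * The real-valued modulus and complex limits *)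

Section ComplexModulus.
Context {R : realType}.
Implicit Types (z w : Cplx R) (r K : R).

Lemma normrE_cabs z : `|z : R[i]| = (cabs z)%:C%C.
Proof. by []. Qed.

Lemma cabs_ge0 z : 0 <= cabs z.
Proof. by rewrite -ler0c -normrE_cabs. Qed.

Lemma cabs0 : cabs (0 : Cplx R) = 0.
Proof. exact: ComplexField.Normc.normc0. Qed.

Lemma cabs1 : cabs (1 : R[i]) = 1.
Proof. exact: ComplexField.Normc.normc1. Qed.

Lemma cabs_eq0 z : (cabs z == 0) = (z == 0).
Proof.
by apply/eqP/eqP => [/ComplexField.Normc.eq0_normc//|->]; rewrite cabs0.
Qed.

Lemma cabsM (z w : R[i]) : cabs (z * w : R[i]) = cabs z * cabs w.
Proof. exact: ComplexField.Normc.normcM. Qed.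

Lemma cabsN z : cabs (- z) = cabs z.
Proof. exact: normcN. Qed.

Lemma cabsD z w : cabs (z + w) <= cabs z + cabs w.
Proof. exact: le_normcD. Qed.

Lemma cabsB z w : cabs (z - w) <= cabs z + cabs w.
Proof. by rewrite (le_trans (cabsD _ _))// cabsN. Qed.

Lemma cabs_real r : 0 <= r -> cabs (r%:C%C : Cplx R) = r.
Proof. by move=> r0; rewrite /cabs /= expr0n addr0 sqrtr_sqr ger0_norm. Qed.

Lemma cabs_nat n : cabs (n%:R : R[i]) = n%:R.
Proof. by rewrite -(cabs_real (ler0n R n)) rmorph_nat. Qed.

Lemma normr_Re_le z : `|complex.Re z| <= cabs z.
Proof.
rewrite -lecR; exact: normc_ge_Re.
Qed.

Lemma normr_Im_le z : `|complex.Im z| <= cabs z.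
Proof.
case: z => x y; rewrite /cabs /= -sqrtr_sqr ler_wsqrtr//.
by rewrite lerDr sqr_ge0.
Qed.

Lemma cabs_le_ReIm z : cabs z <= `|complex.Re z| + `|complex.Im z|.
Proof.
case: z => x y /=; rewrite /cabs /=.
rewrite -[leRHS]ger0_norm ?addr_ge0// -sqrtr_sqr ler_wsqrtr//.
by rewrite sqrrD !real_normK ?num_real// lerD2r lerDl mulrn_wge0//.
Qed.

Lemma complex_geometric_limit (u : nat -> Cplx R) K :
  (forall n, cabs (u n) <= K / 2 ^+ n) ->
  exists l : Cplx R,
    forall N, cabs (l - \sum_(n < N) u n) <= 4 * K / 2 ^+ N.
Proof.
move=> uK.
have [x hx] := geometric_limit (fun n => le_trans (normr_Re_le _) (uK n)).
have [y hy] := geometric_limit (fun n => le_trans (normr_Im_le _) (uK n)).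
exists (Complex x y) => N.
have -> : 4 * K / 2 ^+ N = 2 * K / 2 ^+ N + 2 * K / 2 ^+ N.
  by rewrite -!mulrDl -natrD.
apply: le_trans (cabs_le_ReIm _) _.
by rewrite lerD// raddfB raddf_sum; [exact: hx | exact: hy].
Qed.

(** The device by which identities between partial sums pass to the limit. *)
Lemma cabs_le_eps z K : (forall N, cabs z <= K / 2 ^+ N) -> z = 0.
Proof.
move=> zK; apply/eqP; rewrite -cabs_eq0; apply/eqP/le_anti.
rewrite cabs_ge0 andbT; apply/ler_addgt0Pl => e e0; rewrite addr0.
have K0 : 0 <= K.
  by have := zK 0%N; rewrite expr0 divr1; apply: le_trans; exact: cabs_ge0.
have [N hN] : exists N : nat, K / e < N%:R.
  by exists (Num.truncn (K / e)).+1; exact: truncnS_gt.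
apply: (le_trans (zK N)); rewrite ler_pdivrMr ?exprn_gt0// mulrC -ler_pdivrMr//.
apply: (le_trans (ltW hN)); rewrite -natrX ler_nat ltnW//.
exact: ltn_expl.
Qed.
End ComplexModulus.

(** * Bounds on coefficients, falling factorials and terms *)

Section BinomialSeries.
Context {R : realType}.
Implicit Types (a : nat -> Cplx R) (z h : Cplx R) (s K r rho : R) (n N : nat).

Lemma chi_term_ge0 a n : (0 <= chi_term a n)%E.
Proof.
rewrite /chi_term; case: ifPn => // a1; apply: mule_ge0.
  case: n a1 => [|n] _; first by rewrite mul0r.
  by rewrite lee_fin mulr_ge0// ln_ge0// ler1n.
by rewrite inve_ge0 oppe_ge0 lne_le0 lee_fin ltW.
Qed.

Lemma chi_ge0 a : (0 <= chi a)%E.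
Proof.
apply: limf_esup_ge0 => [|n]; last exact: chi_term_ge0.
exact: filter_not_empty.
Qed.

(** The value +oo rules out |a_n| >= 1; otherwise - ln |a_n| > 0 and one can cross-multiply, the
    case a_n = 0 being trivial. *)
Lemma chi_term_lt a n s : 0 < s -> (chi_term a n < s%:E)%E ->
  cabs (a n) <= expR (- (n%:R * ln n%:R / s)).
Proof.
move=> s0; rewrite /chi_term; case: ifPn => // a1.
have := cabs_ge0 (a n); rewrite le_eqVlt => /predU1P[<- _|a0].
  exact: expR_ge0.
rewrite lne_EFin// -EFinN inver oppr_eq0.
have lna : ln (cabs (a n)) < 0 by rewrite ln_lt0// a0.
rewrite lt_eqF// -EFinM lte_fin => h.
rewrite -[cabs _]lnK ?posrE// ler_expR.
move: h; rewrite ltr_pdivrMr ?oppr_gt0// => h.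
by rewrite lerNr ler_pdivrMr// [_ * s]mulrC ltW.
Qed.

Lemma chi_term_le a n s : 0 < s -> cabs (a n) < 1 ->
  cabs (a n) <= expR (- (n%:R * ln n%:R / s)) -> (chi_term a n <= s%:E)%E.
Proof.
move=> s0 a1 h; rewrite /chi_term a1.
have := cabs_ge0 (a n); rewrite le_eqVlt => /predU1P[<-|a0].
  by rewrite le0_lneNy// invey mule0 lee_fin ltW.
rewrite lne_EFin// -EFinN inver oppr_eq0.
have lna : ln (cabs (a n)) < 0 by rewrite ln_lt0// a0.
rewrite lt_eqF// -EFinM lee_fin.
move: h; rewrite -{1}[cabs _]lnK ?posrE// ler_expR => h.
by rewrite ler_pdivrMr ?oppr_gt0// [s * _]mulrC -ler_pdivrMr// -lerNr.
Qed.

(** For t strictly between chi and s, the product is eventually at most exp(- n ln n (1/t - 1/s)),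
    which is below 2^-n once ln n (1/t - 1/s) >= ln 2. *)
Lemma chi_coef_bound a s : 0 < s -> (chi a < s%:E)%E ->
  exists2 K, 0 <= K &
    forall n, cabs (a n) * expR (n%:R * ln n%:R / s) <= K / 2 ^+ n.
Proof.
move=> s0 chis; have chi0 := chi_ge0 a.
have cf : chi a \is a fin_num.
  by rewrite ge0_fin_numE// (lt_trans chis)// ltry.
set c := fine (chi a); have cE : chi a = c%:E by rewrite fineK.
have cs : c < s by move: chis; rewrite cE lte_fin.
have c0 : 0 <= c by move: chi0; rewrite cE lee_fin.
pose t := (c + s) / 2.
have t0 : 0 < t by rewrite /t; lra.
have ts : t < s by rewrite /t; lra.
have : \forall n \near \oo, (chi_term a n < t%:E)%E.
  apply: limf_esup_lt; change (chi a < t%:E)%E.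
  by rewrite cE lte_fin /t; lra.
case=> N1 _ hN1.
have d0 : 0 < t^-1 - s^-1 by rewrite subr_gt0 ltf_pV2.
have [N2 _ hN2] := nbhs_infty_gtr (expR (ln 2 / (t^-1 - s^-1))).
apply: (@eventually_geometric _ _ (maxn N1 N2)).
  by move=> n; rewrite mulr_ge0 ?cabs_ge0 ?expR_ge0.
move=> n; rewrite geq_max => /andP[/hN1/= /(chi_term_lt t0) an /hN2/= nbig].
apply: le_trans (ler_wpM2r (expR_ge0 _) an) _.
have n0 : 0 < n%:R :> R by apply: lt_trans nbig; exact: expR_gt0.
have ln2 : 0 < ln 2 :> R by rewrite ln_gt0// ltr1n.
rewrite -expRD div1r -[2 ^+ n]lnK ?posrE ?exprn_gt0// -expRN ler_expR lnXn//.
rewrite lerNr -[ln 2 *+ n]mulr_natl opprD opprK.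
have -> : n%:R * ln n%:R / t - n%:R * ln n%:R / s =
    n%:R * (ln n%:R * (t^-1 - s^-1)) by ring.
apply: ler_wpM2l; first exact: ltW.
rewrite -ler_pdivrMr//.
by rewrite -ler_expR lnK ?posrE ?(ltW nbig).
Qed.

Lemma ffallS z n : ffall z n.+1 = (ffall z n : R[i]) * ((z : R[i]) - n%:R).
Proof. by rewrite /ffall big_ord_recr. Qed.

(* [ffall_d1 z n] is the derivative of [ffall z n], and [ffall_d2 z h n] the *)
(* quotient by [h ^+ 2] of its first-order Taylor remainder at [z + h].     *)
Fixpoint ffall_d1 (z : R[i]) n : R[i] :=
  if n is m.+1 then ffall_d1 z m * (z - m%:R) + ffall z m else 0.

Fixpoint ffall_d2 (z h : R[i]) n : R[i] :=
  if n is m.+1 then ffall_d2 z h m * (z + h - m%:R) + ffall_d1 z m else 0.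

Lemma ffall_expand (z h : R[i]) n :
  ffall (z + h) n = ffall z n + h * ffall_d1 z n + h ^+ 2 * ffall_d2 z h n :> R[i].
Proof.
elim: n => [|n IH]; first by rewrite /ffall !big_ord0 /= !mulr0 !addr0.
rewrite !ffallS IH /=; ring.
Qed.

Lemma cabs_subn_le (z : R[i]) n rho : cabs z <= rho ->
  cabs (z - n%:R : R[i]) <= rho + n%:R.
Proof. by move=> zr; rewrite (le_trans (cabsB _ _))// cabs_nat lerD2r. Qed.

Lemma exp_add_step rho n : 0 <= rho ->
  (rho + n%:R) ^+ n * (rho + n%:R) <= (rho + n.+1%:R) ^+ n.+1.
Proof.
by move=> r0; rewrite -exprSr lerXn2r ?nnegrE ?addr_ge0// lerD2l ler_nat.
Qed.

Lemma cabs_ffall_le z n rho : cabs z <= rho ->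
  cabs (ffall z n) <= (rho + n%:R) ^+ n.
Proof.
move=> zr; have r0 := le_trans (cabs_ge0 _) zr.
elim: n => [|n IH]; first by rewrite /ffall big_ord0 cabs1 expr0.
apply: le_trans (exp_add_step n r0); rewrite ffallS cabsM.
by rewrite ler_pM ?cabs_ge0// cabs_subn_le.
Qed.

(** The spare unit in rho pays for the summand [ffall z m] of the recursion: P (rho - 1 + m) + P = P
    (rho + m). *)
Lemma cabs_ffall_d1_le z n rho : cabs z + 1 <= rho ->
  cabs (ffall_d1 z n : R[i]) <= (rho + n%:R) ^+ n.
Proof.
move=> zr; have z0 := cabs_ge0 z; have r0 : 0 <= rho by lra.
elim: n => [|n IH]; first by rewrite [cabs _]cabs0 expr0.
apply: le_trans (exp_add_step n r0); rewrite /= (le_trans (cabsD _ _))// cabsM.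
have zr' : cabs z <= rho - 1 by lra.
have := ler_pM (cabs_ge0 _) (cabs_ge0 _) IH (cabs_subn_le n zr').
have := cabs_ffall_le n (le_trans zr' (_ : rho - 1 <= rho)).
rewrite gerBl => /(_ ler01); move: (_ ^+ n) (cabs _ * cabs _) => P q; lra.
Qed.

(** Of the two spare units, one absorbs the shift by h and the other the summand [ffall_d1 z m]. *)
Lemma cabs_ffall_d2_le z h n rho : cabs h <= 1 -> cabs z + 2 <= rho ->
  cabs (ffall_d2 z h n : R[i]) <= (rho + n%:R) ^+ n.
Proof.
move=> h1 zr; have z0 := cabs_ge0 z; have r0 : 0 <= rho by lra.
elim: n => [|n IH]; first by rewrite [cabs _]cabs0 expr0.
apply: le_trans (exp_add_step n r0); rewrite /= (le_trans (cabsD _ _))// cabsM.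
have zr' : cabs (z + h) <= rho - 1 by have := cabsD z h; lra.
have zr1 : cabs z + 1 <= rho by lra.
have := ler_pM (cabs_ge0 _) (cabs_ge0 _) IH (cabs_subn_le n zr').
have := cabs_ffall_d1_le n zr1.
by move: (_ ^+ n) (cabs _ * cabs _) => P q; lra.
Qed.

(** Here w stands for [ffall], [ffall_d1] or [ffall_d2], so that one estimate serves the sum, its
    derivative and the Taylor remainder. *)
Lemma series_term_le a (w : nat -> Cplx R) s K rho : 0 < s -> s <= 1 ->
  0 <= rho ->
  (forall n, cabs (a n) * expR (n%:R * ln n%:R / s) <= K / 2 ^+ n) ->
  (forall n, cabs (w n) <= (rho + n%:R) ^+ n) ->
  forall n, cabs ((a n : R[i]) * (w n : R[i]) : R[i]) <=
    K * expR (rho `^ s / s) / 2 ^+ n.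
Proof.
move=> s0 s1 r0 aK wr n; rewrite cabsM.
have := ler_wpM2l (cabs_ge0 (a n)) (le_trans (wr n) (exp_add_le n s0 s1 r0)).
move/le_trans; apply; rewrite mulrA [leRHS]mulrAC.
by rewrite ler_wpM2r ?expR_ge0.
Qed.
End BinomialSeries.

(** * The sum: existence, differentiability, uniform convergence *)

Section BinomialSeriesSum.
Context {R : realType} (a : nat -> Cplx R).
Implicit Types (y : Cplx R -> Cplx R) (z : Cplx R) (s K r : R) (N : nat).

Definition coef_bound s K :=
  forall n, cabs (a n) * expR (n%:R * ln n%:R / s) <= K / 2 ^+ n.

(** The error is explicit in z as well as N: bounded |z| gives uniformity, and N = 0 bounds y
    itself. *)
Definition converges_at_rate y s K :=
  forall z N, cabs (y z - binomial_psum a N z) <=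
    4 * (K * expR (cabs z `^ s / s)) / 2 ^+ N.

Lemma exists_binomial_sum s K : 0 < s -> s <= 1 -> coef_bound s K ->
  exists y, converges_at_rate y s K.
Proof.
move=> s0 s1 aK.
suff /choice : forall z, exists w : Cplx R, forall N,
    cabs (w - binomial_psum a N z) <= 4 * (K * expR (cabs z `^ s / s)) / 2 ^+ N.
  by case=> y yP; exists y.
move=> z; exact: (complex_geometric_limit
  (series_term_le s0 s1 (cabs_ge0 z) aK (fun n => cabs_ffall_le n (lexx _)))).
Qed.

Lemma binomial_sum_unique y y' s s' K K' : converges_at_rate y s K ->
  converges_at_rate y' s' K' -> y = y'.
Proof.
move=> yK yK'; apply/funext => z; apply/eqP; rewrite -subr_eq0; apply/eqP.
pose k := 4 * (K * expR (cabs z `^ s / s)).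
pose k' := 4 * (K' * expR (cabs z `^ s' / s')).
apply: (@cabs_le_eps _ _ (k + k')) => N.
have -> : y z - y' z =
    (y z - binomial_psum a N z) - (y' z - binomial_psum a N z).
  by rewrite opprB addrA subrK.
by rewrite (le_trans (cabsB _ _))// mulrDl lerD// ?yK ?yK'.
Qed.

Lemma binomial_psum_expand N (z h : R[i]) :
  binomial_psum a N (z + h) =
  binomial_psum a N z + h * (\sum_(n < N) (a n : R[i]) * ffall_d1 z n)
  + h ^+ 2 * (\sum_(n < N) (a n : R[i]) * ffall_d2 z h n) :> R[i].
Proof.
rewrite /binomial_psum !mulr_sumr -!big_split /=; apply: eq_bigr => n _.
by rewrite ffall_expand; ring.
Qed.

(** Sum the expansion [ffall_expand] termwise: d is the sum of the a_n [ffall_d1 z n], and the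
    remainder is h^2 e, with e bounded uniformly in h because rho depends on z only. *)
Lemma binomial_sum_diff y s K (z : R[i]) : 0 < s -> s <= 1 -> coef_bound s K ->
  converges_at_rate y s K ->
  exists (d : R[i]) (B : R), forall h : R[i], cabs h <= 1 ->
    cabs ((y (z + h) : R[i]) - y z - h * d : R[i]) <= cabs h ^+ 2 * B.
Proof.
move=> s0 s1 aK yK; pose rho := cabs z + 2.
have z0 : 0 <= cabs z := cabs_ge0 z.
have rho0 : 0 <= rho by rewrite /rho; lra.
have rho1 : cabs z + 1 <= rho by rewrite /rho; lra.
pose k := 4 * (K * expR (rho `^ s / s)).
have [d dP] := complex_geometric_limit
  (series_term_le s0 s1 rho0 aK (fun n => cabs_ffall_d1_le n rho1)).
exists d, k => h h1.
have [e eP] := complex_geometric_limit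
  (series_term_le s0 s1 rho0 aK (fun n => cabs_ffall_d2_le n h1 (lexx rho))).
have ek : cabs e <= k by have := eP 0%N; rewrite big_ord0 subr0 expr0 divr1.
suff -> : (y (z + h) : R[i]) - y z - h * d = h ^+ 2 * e.
  by rewrite cabsM expr2 cabsM -expr2 ler_wpM2l// sqr_ge0.
apply/eqP; rewrite -subr_eq0; apply/eqP.
(* The constants k1, k0, k, k control the truncation errors of y(z + h), y(z), d and e; the last two
   are multiplied by h and h^2, of modulus at most 1. *)
pose k0 := 4 * (K * expR (cabs z `^ s / s)).
pose k1 := 4 * (K * expR (cabs (z + h) `^ s / s)).
apply: (@cabs_le_eps _ _ (k1 + k0 + k + k)) => N.
pose D := \sum_(n < N) (a n : R[i]) * ffall_d1 z n.
pose E := \sum_(n < N) (a n : R[i]) * ffall_d2 z h n.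
have -> : (y (z + h) : R[i]) - y z - h * d - h ^+ 2 * e =
   ((y (z + h) : R[i]) - binomial_psum a N (z + h))
   - ((y z : R[i]) - binomial_psum a N z) - h * (d - D) - h ^+ 2 * (e - E).
  by rewrite binomial_psum_expand -/D -/E; ring.
rewrite !mulrDl; apply: le_trans (cabsB _ _) _; apply: lerD; last first.
  rewrite cabsM (le_trans _ (eP N))// ler_piMl ?cabs_ge0//.
  by rewrite expr2 cabsM mulr_ile1 ?cabs_ge0.
apply: le_trans (cabsB _ _) _; apply: lerD; last first.
  by rewrite cabsM (le_trans _ (dP N))// ler_piMl ?cabs_ge0.
by apply: le_trans (cabsB _ _) _; apply: lerD; exact: yK.
Qed.

Lemma binomial_sum_entire y s K : 0 < s -> s <= 1 -> coef_bound s K ->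
  converges_at_rate y s K -> entire y.
Proof.
move=> s0 s1 aK yK z; have [d [B dP]] := binomial_sum_diff z s0 s1 aK yK.
apply/cvg_ex; exists d; apply/cvgrPdist_le => eps eps0.
pose e := complex.Re eps.
have epsE : eps = e%:C%C by rewrite RRe_real// gtr0_real.
have e0 : 0 < e by rewrite -ltcR -epsE.
(* The 1 keeps h in the range of [dP]; |B| + 1 is positive whatever the sign of B. *)
pose del := Num.min 1 (e / (`|B| + 1)).
have B1 : 0 < `|B| + 1 by rewrite ltr_wpDl.
have del0 : 0 < del by rewrite lt_min ltr01 divr_gt0.
have del0' : 0 < del%:C%C by rewrite ltcR.
near=> h.
have h0 : h != 0 :> R[i] by near: h; exact: nbhs_dnbhs_neq.
have hdel : `|h : R[i]| <= del%:C%C by near: h; exact: (dnbhs0_le del0').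
have chdel : cabs h <= del by rewrite -lecR.
move: chdel; rewrite le_min => /andP[h1 hB].
rewrite epsE.
rewrite [`|_|](_ : _ = (cabs (d - h^-1 * ((y (z + h) : R[i]) - y z)))%:C%C);
    last first.
  have hz : h *: (1 : R[i]) + z = (z : R[i]) + h by rewrite [h *: 1]mulr1 addrC.
  by rewrite -hz.
have -> : d - h^-1 * ((y (z + h) : R[i]) - y z) =
    - (h^-1 * ((y (z + h) : R[i]) - y z - h * d)) by field.
rewrite lecR cabsN cabsM.
have ch0 : 0 < cabs h by rewrite lt_neqAle eq_sym cabs_eq0 h0 cabs_ge0.
have -> : cabs (h^-1 : R[i]) = (cabs h)^-1 by exact: ComplexField.Normc.normcV.
rewrite mulrC ler_pdivrMr// (le_trans (dP h h1))// expr2 -mulrA [leRHS]mulrC.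
rewrite ler_pM2l// (le_trans (ler_wpM2l (ltW ch0) (_ : B <= `|B| + 1)))//.
  by rewrite (le_trans (ler_norm B))// lerDl.
by rewrite -ler_pdivlMr.
Unshelve. all: by end_near. Qed.

(** Near-covering compactness for |z| <= n as n tends to infinity: on the unit ball around z, every
    n >= |z| + 1 will do. *)
Lemma compact_cabs_bounded (A : set (Cplx R)) : compact A ->
  exists r, forall z, A z -> cabs z <= r.
Proof.
move=> /compact_near_coveringP/(_ nat \oo (fun n z => cabs z <= n%:R)).
case=> [z Az|N _ /(_ N (leqnn N)) AN]; last by exists N%:R.
exists ([set w | `|(z : Cplx R) - w| <= (1 : R[i])],
    [set n : nat | cabs z + 1 <= n%:R]) => /=.
  split; last exact: nbhs_infty_ger.
  have := @cvgrPdist_le _ (Cplx R) _ (nbhs z) _ id z => -[/(_ _) h _].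
  exact: (h cvg_id _ ltr01).
move=> [w n] /= [zw zn]; apply: le_trans zn.
have -> : w = z - (z - w) by rewrite subKr.
by rewrite (le_trans (cabsB _ _))// lerD2l -lecR.
Qed.

Lemma binomial_psum_uniform y s K (A : set (Cplx R)) : 0 < s -> 0 <= K ->
  converges_at_rate y s K -> compact A ->
  {uniform A, binomial_psum a @ \oo --> y}.
Proof.
move=> s0 K0 yK /compact_cabs_bounded[r Ar] P /uniform_nbhs[E [entE EP]].
move: entE; rewrite -entourage_ballE => -[eps /= eps0 epsE].
pose e := complex.Re eps.
have epsE' : eps = e%:C%C by rewrite RRe_real// gtr0_real.
have e0 : 0 < e by rewrite -ltcR -epsE'.
(* The bound r may be negative when A is empty, hence |r|. *)
pose k := 4 * (K * expR (`|r| `^ s / s)).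
have [N _ hN] := nbhs_infty_gtr (k / e).
exists N => // n /= Nn; apply: EP => z Az /=; apply: epsE => /=.
rewrite -ball_normE /= epsE' normrE_cabs ltcR (le_lt_trans (yK z n))//.
apply: (@le_lt_trans _ _ (k / 2 ^+ n)).
  rewrite ler_wpM2r ?invr_ge0 ?exprn_ge0// ler_wpM2l// ler_wpM2l// ler_expR.
  rewrite ler_wpM2r ?invr_ge0 ?(ltW s0)// ge0_ler_powR ?nnegrE ?cabs_ge0 ?(ltW s0)//.
  by rewrite (le_trans (Ar z Az))// ler_norm.
have := hN n Nn; rewrite /= ltr_pdivrMr// ltr_pdivrMr ?exprn_gt0// mulrC => h.
rewrite (lt_le_trans h)// ler_pM2l// -natrX ler_nat ltnW//.
exact: ltn_expl.
Qed.
End BinomialSeriesSum.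

(** * Maximum modulus and order of growth *)

Section Growth.
Context {R : realType}.
Implicit Types (f : Cplx R -> Cplx R) (r s B : R).

Lemma max_modulus_le f r B : 0 <= r ->
  (forall z, cabs z = r -> cabs (f z) <= B) -> max_modulus f r <= B.
Proof.
move=> r0 fB; apply: ge_sup => [|_ [z /= zr <-]]; last exact: fB.
by exists (cabs (f r%:C%C)); exists (r%:C%C); [exact: cabs_real|].
Qed.

(** The bound B makes the supremum a genuine one. *)
Lemma le_max_modulus f r B z : (forall z, cabs z = r -> cabs (f z) <= B) ->
  cabs z = r -> cabs (f z) <= max_modulus f r.
Proof.
move=> fB zr; apply: ub_le_sup; last by exists z.
by exists B => _ [w /= wr <-]; exact: fB.
Qed.

Lemma ln_le_of_le_exp (M x : R) : 0 <= x -> M <= expR x -> ln M <= x.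
Proof.
move=> x0 Mx; have [M0|M0] := leP M 0; first by rewrite ln0.
by rewrite -ler_expR lnK ?posrE.
Qed.

Lemma growth_order_le f s t B : 0 < s -> s < t -> 0 <= B ->
  (forall z, cabs (f z) <= B * expR (cabs z `^ s / s)) ->
  (growth_order f <= t%:E)%E.
Proof.
move=> s0 st B0 fB; apply: limf_esup_le.
(* For r >= 1 the exponent r^s / s + ln (1 + B) is at most k r^s, hence at most r^t once r^(t-s) >=
   k; 1 + B keeps the logarithm meaningful at B = 0. *)
pose k := s^-1 + ln (1 + B).
have k0 : 0 < k by rewrite ltr_pwDl ?invr_gt0// ln_ge0// lerDl.
have d0 : 0 < t - s by rewrite subr_gt0.
near=> r => /=.
have r1 : 1 < r by near: r; exact: nbhs_pinfty_gt.
have rk : k `^ (t - s)^-1 < r by near: r; exact: nbhs_pinfty_gt.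
have r0 : 0 < r by apply: lt_trans r1.
have lnr : 0 < ln r by rewrite ln_gt0.
rewrite lee_fin ler_pdivrMr// ln_le_of_le_exp//.
  by rewrite mulr_ge0// ltW// (lt_trans s0).
have -> : expR (t * ln r) = r `^ t by rewrite /powR gt_eqF.
have kr : k <= r `^ (t - s).
  apply: (@le_trans _ _ ((k `^ (t - s)^-1) `^ (t - s))).
    by rewrite -powRrM mulVf ?gt_eqF// powRr1// ltW.
  by rewrite ge0_ler_powR ?nnegrE ?powR_ge0 ?(ltW d0) ?(ltW r0) ?(ltW rk).
have rs1 : 1 <= r `^ s by rewrite -(powRr0 r) ler_powR ?(ltW r1) ?(ltW s0).
have rt : r `^ s / s + ln (1 + B) <= r `^ t.
  have -> : t = s + (t - s) by rewrite addrC subrK.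
  rewrite powRD; last by rewrite (gt_eqF r0) implybT.
  apply: le_trans (ler_wpM2l (powR_ge0 _ _) kr).
  by rewrite /k mulrDr lerD2l ler_peMl// ln_ge0// lerDl.
apply: ln_le_of_le_exp; first exact: powR_ge0.
apply: (max_modulus_le (ltW r0)) => z zr.
apply: (le_trans (fB z)); rewrite zr.
apply: (@le_trans _ _ (expR (r `^ s / s + ln (1 + B)))); last by rewrite ler_expR.
rewrite expRD mulrC lnK ?posrE ?ltr_pwDl// ler_wpM2l ?expR_ge0//.
by rewrite lerDr.
Unshelve. all: by end_near. Qed.

Lemma growth_order_lt f s : 0 < s -> (growth_order f < s%:E)%E ->
  \forall r \near +oo, max_modulus f r <= expR (r `^ s).
Proof.
move=> s0 /limf_esup_lt fs; near=> r.
have r1 : 1 < r by near: r; exact: nbhs_pinfty_gt.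
have r0 : 0 < r by apply: lt_trans r1.
have : ((ln (ln (max_modulus f r)) / ln r)%:E < s%:E)%E by near: r; exact: fs.
rewrite lte_fin ltr_pdivrMr ?ln_gt0// => h.
have [M0|M0] := leP (max_modulus f r) 0.
  by rewrite (le_trans M0)// expR_ge0.
rewrite -[max_modulus f r]lnK ?posrE// ler_expR.
have [l0|l0] := leP (ln (max_modulus f r)) 0.
  by rewrite (le_trans l0)// powR_ge0.
by rewrite -[ln _]lnK ?posrE// /powR gt_eqF// ler_expR ltW.
Unshelve. all: by end_near. Qed.

(** Since [ln] is 0 at nonpositive arguments, a negative value of ln ln M forces ln M > 0; so M
    exceeds 1 but tends to 1. *)
Lemma growth_order_lt0 f : (growth_order f < 0)%E -> exists2 e : R, 0 < e &
  \forall r \near +oo, 0 < ln (max_modulus f r) < r `^ (- e).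
Proof.
move=> g0; have [x gx x0] : exists2 x : R, (growth_order f < x%:E)%E & x < 0.
  case: (growth_order f) g0 => [x| |] //.
    by rewrite lte_fin => x0; exists (x / 2); rewrite ?lte_fin; lra.
  by exists (-1); [exact: ltNyr | exact: ltrN10].
exists (- x); first by rewrite oppr_gt0.
have /limf_esup_lt fs := gx; near=> r.
have r1 : 1 < r by near: r; exact: nbhs_pinfty_gt.
have r0 : 0 < r by apply: lt_trans r1.
have lnr : 0 < ln r by rewrite ln_gt0.
have : ((ln (ln (max_modulus f r)) / ln r)%:E < x%:E)%E by near: r; exact: fs.
rewrite lte_fin ltr_pdivrMr// opprK => h.
have l0 : 0 < ln (max_modulus f r).
  rewrite ltNge; apply/negP => l0; move: h; rewrite ln0// ltNge.
  by rewrite (ltW (_ : x * ln r < 0))// nmulr_rlt0.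
by rewrite l0 -{1}[ln _]lnK ?posrE// /powR gt_eqF// ltr_expR.
Unshelve. all: by end_near. Qed.
End Growth.

(** * Coefficients bounded by the maximum modulus *)

Section GrowthBinomialSum.
Context {R : realType} (a : nat -> Cplx R) (y : Cplx R -> Cplx R) (s0 K0 : R).
Hypothesis K0_ge0 : 0 <= K0.
Hypothesis yK : converges_at_rate a y s0 K0.
Implicit Types (r s : R) (z : Cplx R) (n N : nat).

Lemma binomial_sum_bound z : cabs (y z) <= 4 * K0 * expR (cabs z `^ s0 / s0).
Proof.
by have := yK z 0; rewrite /binomial_psum big_ord0 subr0 expr0 divr1 mulrA.
Qed.

Lemma binomial_sum_le_max_modulus z : cabs (y z) <= max_modulus y (cabs z).
Proof.
by apply: (@le_max_modulus _ _ _ (4 * K0 * expR (cabs z `^ s0 / s0))) => // w <-;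
  exact: binomial_sum_bound.
Qed.

Lemma newton_poly_horner N z :
  (newton_poly N a (fun i => i%:R)).[z : R[i]] = binomial_psum a N z.
Proof.
rewrite /newton_poly horner_sum; apply: eq_bigr => n _.
rewrite hornerZ horner_prod; congr (_ * _).
by apply: eq_bigr => i _; rewrite !hornerE.
Qed.

(** On |z| = r the N-th partial sum is at most M(r, y) + k / 2^N, and the nodes 0, ..., n lie in the
    half disc; apply [newton_coef_bound] and let N grow. *)
Lemma binomial_coef_le r n : 0 < r -> n%:R <= r / 2 ->
  cabs (a n) * r ^+ n <= 2 * 6 ^+ n * max_modulus y r.
Proof.
move=> r0 nr; pose k := 4 * (K0 * expR (r `^ s0 / s0)).
have k_ge0 : 0 <= k by rewrite !mulr_ge0 ?expR_ge0.
have key N : (n < N)%N ->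
    cabs (a n) * r ^+ n <= 2 * 6 ^+ n * (max_modulus y r + k / 2 ^+ N).
  move=> nN; have rC : 0 < r%:C%C :> R[i] by rewrite ltcR.
  rewrite -lecR.
  have -> : (cabs (a n) * r ^+ n)%:C%C = `|a n : R[i]| * r%:C%C ^+ n.
    by rewrite rmorphM rmorphXn.
  have -> : (2 * 6 ^+ n * (max_modulus y r + k / 2 ^+ N))%:C%C =
      2 * 6 ^+ n * (max_modulus y r + k / 2 ^+ N)%:C%C :> R[i].
    by rewrite !rmorphM rmorphXn /= !rmorph_nat.
  apply: (newton_coef_bound (N := N) (x := fun i => i%:R) nN rC).
    move=> i ni; rewrite normr_nat.
    have -> : r%:C%C / 2 = (r / 2)%:C%C :> R[i] by rewrite rmorphM fmorphV rmorph_nat.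
    rewrite -(rmorph_nat (real_complex R)) lecR (le_trans _ nr)// ler_nat//.
  move=> z; rewrite normrE_cabs => /(@complexI _ _ _) zr.
  rewrite newton_poly_horner normrE_cabs lecR.
  have -> : binomial_psum a N z = y z - (y z - binomial_psum a N z) by rewrite subKr.
  rewrite (le_trans (cabsB _ _))// lerD//.
    by rewrite -zr binomial_sum_le_max_modulus.
  by rewrite /k -zr; exact: yK.
apply/ler_addgt0Pl => e e0.
pose c := 2 * 6 ^+ n * k.
have [N hN] : exists N : nat, c / e < N%:R.
  by exists (Num.truncn (c / e)).+1; exact: truncnS_gt.
(* The index must exceed n for a_n to occur in the partial sum. *)
have := key (maxn n.+1 N) (leq_maxl _ _); rewrite mulrDr mulrA => /le_trans.
apply; rewrite [leRHS]addrC lerD2l -/c ler_pdivrMr ?exprn_gt0// mulrC -ler_pdivrMr//.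
apply: (le_trans (ltW hN)); rewrite -natrX ler_nat.
by rewrite (leq_trans (leq_maxr n.+1 N))// ltnW// ltn_expl.
Qed.

End GrowthBinomialSum.

(** * Nonnegativity of the order, and chi bounded by the order *)

Section OrderOfBinomialSum.
Context {R : realType} (a : nat -> Cplx R) (y : Cplx R -> Cplx R) (s0 K0 : R).
Hypothesis K0_ge0 : 0 <= K0.
Hypothesis yK : converges_at_rate a y s0 K0.
Implicit Types (r s : R) (z : Cplx R) (n N : nat).

Let coef_le := binomial_coef_le K0_ge0 yK.

Lemma binomial_sum_constant : (forall n, a n.+1 = 0) -> forall z, y z = a 0.
Proof.
move=> a0 z; apply/eqP; rewrite -subr_eq0; apply/eqP.
pose k := 4 * (K0 * expR (cabs z `^ s0 / s0)).
have k0 : 0 <= k by rewrite !mulr_ge0 ?expR_ge0.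
apply: (@cabs_le_eps _ _ k) => N; have := yK z N.+1.
rewrite /binomial_psum big_ord_recl /ffall big_ord0 mulr1.
rewrite big1 => [|i _]; last by rewrite a0 mul0r.
rewrite addr0 => /le_trans; apply; rewrite -/k ler_wpM2l//.
by rewrite lef_pV2 ?posrE ?exprn_gt0// ler_eXn2l ?ltr1n.
Qed.

(** A negative order would give 0 < ln M(r) < r^-e for large r. A nonzero a_n with n >= 1 makes M
    grow at least like r^n; otherwise y is constant and ln M(r) is a fixed positive number. Both are
    impossible. *)
Lemma growth_order_ge0 : (0 <= growth_order y)%E.
Proof.
rewrite leNgt; apply/negP => /growth_order_lt0[e e0 lnM].
have [[n an]|const] := pselect (exists n, a n.+1 != 0).
  pose q : R := 2 * 6 ^+ n.+1 * expR 1.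
  have a0 : 0 < cabs (a n.+1) by rewrite lt_neqAle eq_sym cabs_eq0 an cabs_ge0.
  near (+oo%R : set_system R) => r.
  have r1 : 1 < r by near: r; exact: nbhs_pinfty_gt.
  have rn : 2 * n.+1%:R < r by near: r; exact: nbhs_pinfty_gt.
  have rq : q / cabs (a n.+1) < r.
    by near: r; apply: nbhs_pinfty_gt; exact: num_real.
  have r0 : 0 < r by apply: lt_trans r1.
  have /andP[l0 lr] : 0 < ln (max_modulus y r) < r `^ (- e) by near: r; exact: lnM.
  have M0 : 0 < max_modulus y r.
    by rewrite ltNge; apply/negP => M0; move: l0; rewrite ln0// ltxx.
  have Me : max_modulus y r <= expR 1.
    rewrite -[leLHS]lnK ?posrE// ler_expR (le_trans (ltW lr))//.
    by rewrite -(powRr0 r) ler_powR ?(ltW r1)// oppr_le0 ltW.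
  have nr : n.+1%:R <= r / 2 by rewrite ler_pdivlMr// mulrC ltW.
  have := coef_le r0 nr; apply/negP; rewrite -ltNge.
  apply: (@le_lt_trans _ _ q); first by rewrite ler_wpM2l//.
  move: rq; rewrite ltr_pdivrMr// mulrC => /lt_le_trans; apply.
  by rewrite ler_pM2l// exprS ler_peMr ?(ltW r0)// exprn_ege1// ltW.
have a0 n : a n.+1 = 0.
  by apply/eqP/negPn/negP => an; apply: const; exists n.
have ME r : 0 <= r -> max_modulus y r = cabs (a 0).
  move=> r0; apply/le_anti/andP; split.
    by apply: max_modulus_le => // z _; rewrite (binomial_sum_constant a0).
  have := binomial_sum_le_max_modulus yK (r%:C%C).
  by rewrite cabs_real// (binomial_sum_constant a0).
pose l := ln (cabs (a 0)).
near (+oo%R : set_system R) => r.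
have r1 : 1 < r by near: r; exact: nbhs_pinfty_gt.
have rl : (l^-1) `^ e^-1 < r by near: r; exact: nbhs_pinfty_gt.
have r0 : 0 < r by apply: lt_trans r1.
have : 0 < ln (max_modulus y r) < r `^ (- e) by near: r; exact: lnM.
rewrite (ME r (ltW r0)) -/l => /andP[l0]; apply/negP; rewrite -leNgt powRN.
rewrite -[l]invrK lef_pV2 ?posrE ?invr_gt0 ?powR_gt0//.
apply: (@le_trans _ _ ((l^-1 `^ e^-1) `^ e)).
  by rewrite -powRrM mulVf ?gt_eqF// powRr1// invr_ge0 ltW.
by rewrite ge0_ler_powR ?nnegrE ?powR_ge0 ?(ltW e0) ?(ltW r0) ?(ltW rl).
Unshelve. all: by end_near. Qed.

(** With r = n^(1/s) one has M(r) <= e^n and r^n = exp(n ln n / s), so |a_n| <= 2 (6e)^n exp(- n ln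
    n / s); replacing s by t absorbs the exponential factor for large n. *)
Lemma chi_le_of_growth s t : 0 < s -> s < t -> t <= 1 ->
  (growth_order y < s%:E)%E -> (chi a <= t%:E)%E.
Proof.
move=> sp st t1 /(growth_order_lt sp)[A [_ MA]].
have t0 : 0 < t by apply: lt_trans st.
have s1 : s < 1 by apply: lt_le_trans t1.
have is1 : 1 < s^-1 by rewrite invf_gt1.
have d0 : 0 < s^-1 - t^-1 by rewrite subr_gt0 ltf_pV2.
apply: limf_esup_le; near=> n => /=.
have n1 : (1 : R) < n%:R by near: n; exact: nbhs_infty_gtr.
have nA : A < n%:R by near: n; exact: nbhs_infty_gtr.
(* Ensures n^(1/s - 1) >= 2, that is n <= r / 2. *)
have n2 : 2 `^ (s^-1 - 1)^-1 < n%:R by near: n; exact: nbhs_infty_gtr.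
(* The terms 1, ln 2 and ln 6 pay for e^n, for 2 <= 2^n and for 6^n. *)
have ne : expR ((1 + ln 2 + ln 6) / (s^-1 - t^-1)) < n%:R.
  by near: n; exact: nbhs_infty_gtr.
have n0 : 0 < n%:R :> R by apply: lt_trans n1.
pose r : R := n%:R `^ s^-1.
have r0 : 0 < r by exact: powR_gt0.
have rE : r = n%:R * n%:R `^ (s^-1 - 1) by rewrite mulr_powRB1 ?ltW ?invr_gt0.
have two_le : 2 <= n%:R `^ (s^-1 - 1) :> R.
  have d1 : 0 < s^-1 - 1 by rewrite subr_gt0.
  apply: (@le_trans _ _ ((2 `^ (s^-1 - 1)^-1) `^ (s^-1 - 1))).
    by rewrite -powRrM mulVf ?gt_eqF// powRr1.
  by rewrite ge0_ler_powR ?nnegrE ?powR_ge0 ?(ltW d1) ?(ltW n2).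
have nr : n%:R <= r / 2 by rewrite ler_pdivlMr// rE ler_pM2l.
have rA : A < r.
  rewrite (lt_le_trans nA)// (le_trans nr)// ler_pdivrMr//.
  by rewrite ler_peMr ?ler1n ?ltW.
have rs : r `^ s = n%:R by rewrite /r -powRrM mulVf ?gt_eqF// powRr1// ltW.
have rn : r ^+ n = expR (n%:R * ln n%:R / s).
  by rewrite -[r]lnK ?posrE// -expRM_natl ln_powR mulrA mulrAC.
have M_le : max_modulus y r <= expR n%:R by rewrite -rs; exact: MA.
have ln2 : 0 < ln 2 :> R by rewrite ln_gt0// ltr1n.
have lnn : 0 < ln n%:R :> R by rewrite ln_gt0.
have an : cabs (a n) <= expR (- (n%:R * ln n%:R / t)).
  have := coef_le r0 nr.
  rewrite -ler_pdivlMr ?exprn_gt0// rn -expRN => /le_trans; apply.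
  have E6 : 2 * 6 ^+ n = expR (ln 2 + n%:R * ln 6) :> R.
    by rewrite expRD expRM_natl !lnK ?posrE.
  apply: (@le_trans _ _ (2 * 6 ^+ n * expR n%:R * expR (- (n%:R * ln n%:R / s)))).
    by rewrite ler_wpM2r ?expR_ge0// ler_wpM2l// mulr_ge0// exprn_ge0.
  rewrite E6 -!expRD ler_expR -subr_ge0.
  have big : 1 + ln 2 + ln 6 <= ln n%:R * (s^-1 - t^-1).
    by rewrite -ler_pdivrMr// -ler_expR lnK ?posrE// ltW.
  have h1 := ler_wpM2l (ltW n0) big.
  have h2 : ln 2 <= n%:R * ln 2 :> R by rewrite ler_peMl ?(ltW ln2) ?(ltW n1).
  rewrite -!mulrA; move: h1; rewrite !mulrDr mulr1 mulrN => h1.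
  rewrite -subr_ge0 in h1; rewrite -subr_ge0 in h2; rewrite -[0]addr0.
  apply: le_trans (lerD h1 h2) _; rewrite le_eqVlt; apply/orP; left.
  by apply/eqP; ring.
(* The strict bound |a_n| < 1 keeps [chi_term] away from its value +oo. *)
apply: chi_term_le => //; apply: (le_lt_trans an).
by rewrite expR_lt1 oppr_lt0 divr_gt0// mulr_gt0.
Unshelve. all: by end_near. Qed.
End OrderOfBinomialSum.

Theorem theorem1p1 (R : realType) (a : nat -> Cplx R) (hchi : (chi a < 1)%E) :
  exists y : Cplx R -> Cplx R,
    [/\ forall K : set (Cplx R), compact K ->
          {uniform K, binomial_psum a @ \oo --> y},
        entire y
      & growth_order y = chi a].
Proof.
have [K K0 aK] := chi_coef_bound ltr01 hchi.
have [y yK] := exists_binomial_sum ltr01 (lexx 1) aK.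
exists y; split.
- by move=> A; exact: binomial_psum_uniform ltr01 K0 yK.
- exact: binomial_sum_entire ltr01 (lexx 1) aK yK.
have chi0 := chi_ge0 a.
have chif : chi a \is a fin_num by rewrite ge0_fin_numE// (lt_trans hchi)// ltry.
set c := fine (chi a); have cE : chi a = c%:E by rewrite fineK.
have c1 : c < 1 by move: hchi; rewrite cE lte_fin.
have c0 : 0 <= c by move: chi0; rewrite cE lee_fin.
have upper : (growth_order y <= chi a)%E.
  apply/lee_addgt0Pr => e e0; rewrite cE -EFinD.
  (* An exponent strictly between c and c + e that stays below 1. *)
  pose s := Num.min (c + e / 2) ((c + 1) / 2).
  have cs : c < s by rewrite lt_min; apply/andP; split; lra.
  have sce : s < c + e by rewrite gt_min; apply/orP; left; lra.
  have s1 : s <= 1 by rewrite ge_min; apply/orP; right; lra.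
  have s0 : 0 < s by apply: le_lt_trans cs.
  have chis : (chi a < s%:E)%E by rewrite cE lte_fin.
  have [K' K'0 aK'] := chi_coef_bound s0 chis.
  have [y' yK'] := exists_binomial_sum s0 s1 aK'.
  rewrite (binomial_sum_unique yK yK').
  apply: (@growth_order_le _ _ s _ (4 * K')) => //; first by rewrite mulr_ge0.
  by move=> z; exact: binomial_sum_bound yK' z.
have g0 := growth_order_ge0 K0 yK.
apply/le_anti; rewrite upper /= leNgt; apply/negP => gc.
have gf : growth_order y \is a fin_num.
  by rewrite ge0_fin_numE// (lt_trans gc)// cE ltry.
move: gc; rewrite -(fineK gf) cE lte_fin; set g := fine _ => gc.
(* These cut [g, c] into thirds: the order is below s, so chi <= t < c, a contradiction. *)
pose s := (2 * g + c) / 3; pose t := (g + 2 * c) / 3.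
have gg : 0 <= g by rewrite -lee_fin fineK.
have s0 : 0 < s by rewrite /s; lra.
have st : s < t by rewrite /s /t; lra.
have t1 : t <= 1 by rewrite /t; lra.
have gs : (growth_order y < s%:E)%E.
  by rewrite -(fineK gf) lte_fin -/g /s; lra.
have := chi_le_of_growth K0 yK s0 st t1 gs.
by rewrite cE lee_fin /t; lra.
Qed.
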